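(* Let $(E,d)$ be a $d$-$\sigma$-stable $(\varepsilon,\lambda)$-complete $RM$ space with base $(\Omega,\mathcal{F},P)$, let $T:E\to E$ be a $\sigma$-stable mapping, let $L:\Omega\to N$ be a random variable with values in the positive integers, and let $\alpha\in L^0_+(\mathcal{F})$ be such that $\alpha<1$ on $\Omega$ and $d(T^L(x),T^L(y))\le\alpha\cdot d(x,y)$ for any $x,y\in E$. Then $T$ has a unique fixed point.
   Context: $(\Omega,\mathcal{F},P)$ is a probability space. $L^0(\mathcal{F})$ is the set of equivalence classes (under a.s. equality) of real-valued $\mathcal{F}$-measurable random variables, ordered by $\xi\le\eta$ iff $\xi^0\le\eta^0$ a.s. for representatives. $L^0_+(\mathcal{F})=\{\xi\in L^0(\mathcal{F}):\xi\ge0\}$. ''$\alpha<1$ on $\Omega$'' means that a representative satisfies $\alpha^0<1$ a.s. $\tilde{I}_A$ is the equivalence class of the characteristic function of $A\in\mathcal{F}$. $N$ is the set of positive integers. An $RM$ (random metric) space with base $(\Omega,\mathcal{F},P)$ is a pair $(E,d)$, $E$ a nonempty set and $d:E\times E\to L^0_+(\mathcal{F})$, such that $d(p,q)=0$ iff $p=q$, $d(p,q)=d(q,p)$, and $d(p,r)\le d(p,q)+d(q,r)$. The $(\varepsilon,\lambda)$-uniformity on $E$ has as base the sets $\{(x,y)\in E\times E: P\{\omega: d(x,y)(\omega)<\varepsilon\}>1-\lambda\}$ for real $\varepsilon>0$, $0<\lambda<1$; $(E,d)$ is $(\varepsilon,\lambda)$-complete if it is complete in this uniformity. A countable partition $\{A_n:n\in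 N\}$ of $\Omega$ to $\mathcal{F}$ is a sequence of pairwise disjoint members of $\mathcal{F}$ with union $\Omega$. $E$ is $d$-$\sigma$-stable if for each sequence $\{x_n\}$ in $E$ and each countable partition $\{A_n\}$ of $\Omega$ to $\mathcal{F}$ there is $x\in E$ with $\tilde{I}_{A_n}\cdot d(x,x_n)=0$ for all $n$; such $x$ is unique and is denoted $\sum_{n=1}^\infty\tilde{I}_{A_n}\cdot x_n$. A mapping $T:E\to E$ is $\sigma$-stable if $T(\sum_{n=1}^\infty\tilde{I}_{A_n}\cdot x_n)=\sum_{n=1}^\infty\tilde{I}_{A_n}\cdot T(x_n)$ for each sequence $\{x_n\}$ in $E$ and each countable partition $\{A_n\}$ of $\Omega$ to $\mathcal{F}$. For a random variable $L:\Omega\to N$, $T^L:E\to E$ is defined by $T^L(x)=\sum_{k=1}^\infty\tilde{I}_{(L=k)}\cdot T^k(x)$, where $(L=k)=\{\omega\in\Omega:L(\omega)=k\}$ and $T^k$ is the $k$-th iterate of $T$. *)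

(* Defs.v *)
From HB Require Import structures.
From mathcomp Require Import all_boot all_order all_algebra.
From mathcomp Require Import all_classical all_reals all_analysis.
From mathcomp Require Import measurable_realfun ring lra.

Set Implicit Arguments.
Unset Strict Implicit.
Unset Printing Implicit Defensive.
Import Order.TTheory GRing.Theory Num.Theory.
Import numFieldNormedType.Exports.

Local Open Scope classical_set_scope.
Local Open Scope ring_scope.
Local Open Scope quotient_scope.

Section L0.
Context (disp : measure_display) (Omega : measurableType disp) (R : realType).
Variable P : probability Omega R.

Definition L0 : Type := {mfun_ P, Omega >-> R}.

HB.instance Definition _ := Choice.on L0.

(* A chosen representative. All notions below are independent of the choice;
   see L0_classP. *)
Definition L0_repr (xi : L0) : {mfun Omega >-> R} := repr xi.
Coercion L0_repr : L0 >-> MeasurableFun.type.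

Definition L0_class (f : {mfun Omega >-> R}) : L0 := \pi f.

Lemma L0_reprK : cancel L0_repr L0_class.
Proof. by move=> xi; rewrite /L0_class reprK. Qed.

Lemma L0_classP (f g : {mfun Omega >-> R}) :
  L0_class f = L0_class g <-> {ae P, forall w, f w = g w}.
Proof.
split=> [/eqP|h].
  by rewrite eqmodE => /asboolP; apply: filterS => w; exact.
by apply/eqP; rewrite eqmodE; apply/asboolP; apply: filterS h => w h _.
Qed.

Lemma L0P (xi eta : L0) : xi = eta <-> {ae P, forall w, xi w = eta w}.
Proof. by rewrite -L0_classP !L0_reprK. Qed.

Lemma L0_classE (f : {mfun Omega >-> R}) :
  {ae P, forall w, L0_class f w = f w}.
Proof. by apply/L0_classP; rewrite L0_reprK. Qed.

Definition L0_zero : L0 := L0_class (0 : {mfun Omega >-> R}).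
Definition L0_one : L0 := L0_class (1 : {mfun Omega >-> R}).
Definition L0_opp (xi : L0) : L0 := L0_class (- (xi : {mfun Omega >-> R})).
Definition L0_add (xi eta : L0) : L0 :=
  L0_class ((xi : {mfun Omega >-> R}) + (eta : {mfun Omega >-> R})).
Definition L0_mul (xi eta : L0) : L0 :=
  L0_class ((xi : {mfun Omega >-> R}) * (eta : {mfun Omega >-> R})).

Fact L0_class_opp f : L0_opp (L0_class f) = L0_class (- f).
Proof.
by apply/L0_classP; apply: filterS (L0_classE f) => w; exact: congr1.
Qed.

Fact L0_class_add f g : L0_add (L0_class f) (L0_class g) = L0_class (f + g).
Proof.
apply/L0_classP.
by apply: filterS2 (L0_classE f) (L0_classE g) => w; exact: congr2.
Qed.

Fact L0_class_mul f g : L0_mul (L0_class f) (L0_class g) = L0_class (f * g).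
Proof.
apply/L0_classP.
by apply: filterS2 (L0_classE f) (L0_classE g) => w; exact: congr2.
Qed.

Fact L0_addA : associative L0_add.
Proof.
move=> x y z; rewrite -[x]L0_reprK -[y]L0_reprK -[z]L0_reprK.
by rewrite !L0_class_add addrA.
Qed.

Fact L0_addC : commutative L0_add.
Proof.
by move=> x y; rewrite -[x]L0_reprK -[y]L0_reprK !L0_class_add addrC.
Qed.

Fact L0_add0 : left_id L0_zero L0_add.
Proof. by move=> x; rewrite -[x]L0_reprK !L0_class_add add0r. Qed.

Fact L0_addN : left_inverse L0_zero L0_opp L0_add.
Proof. by move=> x; rewrite -[x]L0_reprK L0_class_opp L0_class_add addNr. Qed.

HB.instance Definition _ :=
  GRing.isZmodule.Build L0 L0_addA L0_addC L0_add0 L0_addN.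

Fact L0_mulA : associative L0_mul.
Proof.
move=> x y z; rewrite -[x]L0_reprK -[y]L0_reprK -[z]L0_reprK.
by rewrite !L0_class_mul mulrA.
Qed.

Fact L0_mulC : commutative L0_mul.
Proof.
by move=> x y; rewrite -[x]L0_reprK -[y]L0_reprK !L0_class_mul mulrC.
Qed.

Fact L0_mul1 : left_id L0_one L0_mul.
Proof. by move=> x; rewrite -[x]L0_reprK !L0_class_mul mul1r. Qed.

Fact L0_mulD : left_distributive L0_mul L0_add.
Proof.
move=> x y z; rewrite -[x]L0_reprK -[y]L0_reprK -[z]L0_reprK.
by rewrite !(L0_class_add, L0_class_mul) mulrDl.
Qed.

HB.instance Definition _ :=
  GRing.Zmodule_isComPzRing.Build L0 L0_mulA L0_mulC L0_mul1 L0_mulD.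

Definition L0_le (xi eta : L0) : bool :=
  `[< {ae P, forall w, xi w <= eta w} >].

Fact L0_le_refl : reflexive L0_le.
Proof. by move=> x; apply/asboolP/aeW. Qed.

Fact L0_le_anti : antisymmetric L0_le.
Proof.
move=> x y /andP[/asboolP xy /asboolP yx]; apply/L0P.
by apply: filterS2 xy yx => w xy yx; apply/eqP; rewrite eq_le xy yx.
Qed.

Fact L0_le_trans : transitive L0_le.
Proof.
move=> y x z /asboolP xy /asboolP yz; apply/asboolP.
by apply: filterS2 xy yz => w; exact: le_trans.
Qed.

HB.instance Definition _ := Order.Le_isPOrder.Build ring_display L0
  L0_le_refl L0_le_anti L0_le_trans.

Lemma L0_leP (xi eta : L0) :
  reflect {ae P, forall w, xi w <= eta w} (xi <= eta).
Proof. exact: asboolP. Qed.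

Lemma L0_0E : {ae P, forall w, (0 : L0) w = 0}.
Proof. exact: L0_classE. Qed.

Lemma L0_addE (xi eta : L0) :
  {ae P, forall w, (xi + eta : L0) w = xi w + eta w}.
Proof. exact: L0_classE. Qed.

Lemma L0_mulE (xi eta : L0) :
  {ae P, forall w, (xi * eta : L0) w = xi w * eta w}.
Proof. exact: L0_classE. Qed.

(* "xi < eta on Omega": strict inequality almost everywhere. This is stronger
   than the strict part [xi < eta] of the order of L0, which only says
   [xi <= eta] and [xi <> eta]. *)
Definition L0_lt_on (xi eta : L0) : Prop := {ae P, forall w, xi w < eta w}.

Definition L0_indic (A : set Omega) (mA : measurable A) : L0 :=
  L0_class (indic_mfun A mA).

End L0.

Section partitions.
Context (disp : measure_display) (Omega : measurableType disp).

(* The pieces may be empty. They are indexed by nat instead of {1, 2, ...}. *)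
Record countable_partition := CountablePartition {
  piece :> nat -> set Omega;
  piece_measurable : forall n, measurable (piece n);
  piece_disjoint : trivIset setT piece;
  piece_cover : \bigcup_n piece n = setT }.

Definition level (L : {mfun Omega >-> nat}) (k : nat) : set Omega :=
  [set w | L w = k.+1].

Variables (L : {mfun Omega >-> nat}) (L_gt0 : forall w, (0 < L w)%N).

Fact level_measurable n : measurable (level L n).
Proof.
rewrite (_ : level L n = setT `&` L @^-1` [set n.+1]); last by rewrite setTI.
exact: measurable_funPT.
Qed.

Fact level_disjoint : trivIset setT (level L).
Proof.
move=> i j _ _ [w [Li Lj]]; apply: succn_inj; exact: etrans (esym Li) Lj.
Qed.

Fact level_cover : \bigcup_n level L n = setT.
Proof.
apply/seteqP; split=> // w _; exists (L w).-1 => //=.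
by rewrite /level/= prednK.
Qed.

(* The n-th piece is (L = n + 1). *)
Definition level_partition : countable_partition :=
  CountablePartition level_measurable level_disjoint level_cover.

End partitions.

Record RMspace (disp : measure_display) (Omega : measurableType disp)
    (R : realType) (P : probability Omega R) := RMSpace {
  RM_carrier :> Type;
  RM_nonempty : inhabited RM_carrier;
  rdist : RM_carrier -> RM_carrier -> L0 P;
  rdist_ge0 : forall p q, 0 <= rdist p q;
  rdist_eq0 : forall p q, rdist p q = 0 <-> p = q;
  rdist_sym : forall p q, rdist p q = rdist q p;
  rdist_triangle : forall p q r, rdist p r <= rdist p q + rdist q r }.

Section uniformity.
Context (disp : measure_display) (Omega : measurableType disp) (R : realType).
Context (P : probability Omega R) (E : RMspace P).

HB.instance Definition _ := gen_eqMixin (RM_carrier E).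
HB.instance Definition _ := gen_choiceMixin (RM_carrier E).

Definition el_vicinity (eps lambda : R) : set (E * E) :=
  [set xy | ((1 - lambda)%:E < P [set w | (rdist xy.1 xy.2 w < eps)%R])%E].

Definition el_entourage : set_system (E * E) :=
  filter_from [set el : R * R | 0 < el.1 /\ 0 < el.2 < 1]
              (fun el => el_vicinity el.1 el.2).

Fact rdist_lt_measurable (x y : E) e : measurable [set w | rdist x y w < e].
Proof.
have := @measurable_funPT _ _ _ _ (rdist x y : {mfun Omega >-> R}).
move=> /(_ measurableT `]-oo, e[%classic (measurable_itv _)).
by rewrite setTI; congr measurable; apply/seteqP; split=> w /=; rewrite in_itv.
Qed.

Fact el_vicinity_le e1 e2 l1 l2 : e1 <= e2 -> l1 <= l2 ->
  el_vicinity e1 l1 `<=` el_vicinity e2 l2.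
Proof.
move=> e12 l12 [x y] /= h.
apply: (@le_lt_trans _ _ (1 - l1)%:E); first by rewrite lee_fin lerB.
apply: (lt_le_trans h); apply: le_measure; rewrite ?inE//=.
- exact: rdist_lt_measurable.
- exact: rdist_lt_measurable.
by move=> w /= /lt_le_trans; exact.
Qed.

Fact el_entourage_filter : Filter el_entourage.
Proof.
apply: filter_from_filter.
  exists (1, 2^-1) => /=; split=> //.
  by rewrite invr_gt0 invf_lt1 ?ltr1n ?ltr0n.
move=> [e1 l1] [e2 l2] /= [e1p /andP[l1p l11]] [e2p /andP[l2p l21]].
exists (Num.min e1 e2, Num.min l1 l2) => /=.
  by rewrite !lt_min e1p e2p l1p l2p gt_min l11.
by move=> xy h; split; apply: el_vicinity_le h; rewrite ge_min lexx ?orbT.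
Qed.

Fact le_measure_ae (A B : set Omega) : measurable A -> measurable B ->
  {ae P, forall w, A w -> B w} -> (P A <= P B)%E.
Proof.
move=> mA mB AB; have mAB : measurable (A `\` B) by exact: measurableD.
have AB0 : P (A `\` B) = 0%E.
  apply/negligibleP => //; apply: negligibleS AB => w [Aw Bw] /=.
  by move=> /(_ Aw).
rewrite (le_trans _ (_ : P (B `|` A `\` B) <= P B)%E)//.
  apply: le_measure; rewrite ?inE//; first exact: measurableU.
  by move=> w Aw; have [Bw|Bw] := pselect (B w); [left|right].
by rewrite (measureU0 mB mAB AB0).
Qed.

Fact el_entourage_diag A : el_entourage A -> diagonal `<=` A.
Proof.
move=> [[e l] /= [e0 /andP[l0 l1]] sA] [x y] xy; apply: sA.
have {xy} <- : x = y by [].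
rewrite /el_vicinity /=.
apply: (@lt_le_trans _ _ 1%E); first by rewrite lte_fin ltrBlDr ltrDl.
rewrite -(@probability_setT _ _ _ P); apply: le_measure_ae => //.
  exact: rdist_lt_measurable.
have -> : rdist x x = 0 by exact/rdist_eq0.
by apply: filterS (L0_0E P) => w /= ->.
Qed.

Fact el_entourage_sym A : el_entourage A -> el_entourage A^-1%relation.
Proof.
move=> [el elp sA]; exists el => // -[x y] h; apply: sA.
by rewrite /el_vicinity /= rdist_sym.
Qed.

Fact el_entourage_split A : el_entourage A ->
  exists2 B, el_entourage B & (B \; B)%relation `<=` A.
Proof.
move=> [[e l] /= [e0 /andP[l0 l1]] sA].
exists (el_vicinity (e / 2) (l / 2)).
  exists (e / 2, l / 2) => //=; split; first by rewrite divr_gt0.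
  by rewrite divr_gt0//= (lt_trans _ l1)// ltr_pdivrMr// ltr_pMr// ltr1n.
move=> [x z] [y /= xy yz]; apply: sA; move: xy yz; rewrite /el_vicinity /=.
set U := [set w | rdist x y w < _]; set V := [set w | rdist y z w < _].
move=> PU PV.
have mU : measurable U by exact: rdist_lt_measurable.
have mV : measurable V by exact: rdist_lt_measurable.
have mUV : measurable (U `&` V) by exact: measurableI.
apply: (@lt_le_trans _ _ (P (U `&` V))); last first.
  apply: le_measure_ae; [exact: mUV|exact: rdist_lt_measurable|].
  apply: filterS2 (L0_addE (rdist x y) (rdist y z))
    (L0_leP _ _ (rdist_triangle x y z)).
  move=> w /= -> xz [Uw Vw]; apply: (le_lt_trans xz).
  by rewrite [ltRHS]splitr ltrD.
have finP A' : measurable A' -> P A' \is a fin_num by exact: fin_num_measure.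
have PUV : (P (U `|` V) = P U + P V - P (U `&` V))%E.
  by apply: measureUfinl => //; rewrite ltey_eq finP.
have : (P (U `|` V) <= 1)%E by apply: probability_le1; exact: measurableU.
rewrite {}PUV; move: PU PV.
rewrite -(fineK (finP _ mU)) -(fineK (finP _ mV)) -(fineK (finP _ mUV)).
rewrite -EFinD !lte_fin lee_fin; lra.
Qed.

HB.instance Definition _ := isUniform.Build (RM_carrier E)
  el_entourage_filter el_entourage_diag el_entourage_sym el_entourage_split.

Definition el_complete : Prop :=
  forall F : set_system E, ProperFilter F -> cauchy F -> exists x : E, F --> x.

End uniformity.

Section stability.
Context (disp : measure_display) (Omega : measurableType disp) (R : realType).
Context (P : probability Omega R) (E : RMspace P).

Definition is_concat (A : countable_partition Omega) (u : nat -> E) (x : E) :=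
  forall n, L0_indic P (piece_measurable A n) * rdist x (u n) = 0.

Lemma is_concat_uniq A u x y : is_concat A u x -> is_concat A u y -> x = y.
Proof.
move=> ux uy; apply/rdist_eq0/L0P.
have rn n :
    {ae P, forall w, A n w -> rdist x (u n) w = 0 /\ rdist y (u n) w = 0}.
  have ae0 z : is_concat A u z ->
      {ae P, forall w, A n w -> rdist z (u n) w = 0}.
    move=> /(_ n)/L0P uz.
    have h1 := L0_mulE (L0_indic P (piece_measurable A n)) (rdist z (u n)).
    have h2 := L0_classE P (indic_mfun (A n) (piece_measurable A n)).
    apply: filterS2 (filterI uz h1) (filterI h2 (L0_0E P)).
    move=> w [e1 e2] [e3 e4] Aw.
    have e5 : L0_indic P (piece_measurable A n) w = 1.
      by apply: (etrans e3); rewrite /= /mindic indicE mem_set.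
    by rewrite -[LHS]mul1r -e5 -e2 e1 e4.
  by apply: filterS2 (ae0 x ux) (ae0 y uy) => w h1 h2 Aw; split; auto.
have tri n := elimT (L0_leP _ _) (rdist_triangle x (u n) y).
have add n := L0_addE (rdist x (u n)) (rdist (u n) y).
have ge0 := elimT (L0_leP _ _) (rdist_ge0 x y).
have : {ae P, forall w, forall n,
    (A n w -> rdist x (u n) w = 0 /\ rdist y (u n) w = 0) /\
    (rdist x y w <= rdist x (u n) w + rdist (u n) y w)}.
  apply/ae_foralln => n; apply: filterS3 (rn n) (tri n) (add n).
  by move=> w h1 h2 h3; split=> //; rewrite -h3.
move=> H; apply: filterS3 H ge0 (L0_0E P) => w h g e; rewrite e in g *.
have [n _ Anw] : (\bigcup_n A n) w by rewrite piece_cover.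
have [/(_ Anw)[x0 y0]] := h n.
rewrite [rdist (u n) y]rdist_sym x0 y0 addr0 => le0.
by apply/eqP; rewrite eq_le le0 g.
Qed.

Definition d_sigma_stable : Prop :=
  forall (u : nat -> E) (A : countable_partition Omega),
    exists x, is_concat A u x.

Hypothesis hE : d_sigma_stable.

(* \sum_n I_(A n) . u n *)
Definition concat (A : countable_partition Omega) (u : nat -> E) : E :=
  projT1 (cid (hE u A)).

Lemma concatP A u : is_concat A u (concat A u).
Proof. exact: projT2 (cid (hE u A)). Qed.

Definition sigma_stable_map (T : E -> E) : Prop :=
  forall (u : nat -> E) (A : countable_partition Omega),
    T (concat A u) = concat A (fun n => T (u n)).

(* \sum_(k >= 1) I_(L = k) . T^k x, reindexed from 0 *)
Definition random_iter (T : E -> E) (L : {mfun Omega >-> nat})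
    (L_gt0 : forall w, (0 < L w)%N) (x : E) : E :=
  concat (level_partition L_gt0) (fun k => iter k.+1 T x).

End stability.

(* Main.v *)
Require Import Defs.
From mathcomp Require Import all_boot all_order all_algebra.
From mathcomp Require Import all_classical all_reals all_analysis.
From mathcomp Require Import lra.

Set Implicit Arguments.
Unset Strict Implicit.
Import Order.TTheory GRing.Theory Num.Theory.
Import numFieldNormedType.Exports.
Local Open Scope classical_set_scope.
Local Open Scope ring_scope.

(** Write S for the random iterate T^L. The hypothesis says that S contracts
    the random metric with the random ratio alpha < 1, so S has exactly one
    fixed point z by a random form of the Banach principle
    ([contraction_fixed_exists], [contraction_fixed_uniq]): at almost every
    sample point the distances between the iterates S^n x0 obey the classical
    geometric estimate, hence the iterates are almost surely Cauchy, hence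
    Cauchy in the (epsilon, lambda)-uniformity, and completeness provides the
    limit.

    It remains to pass from S to T. Sigma-stability makes T commute with S
    ([random_iter_comm]), so S (T z) = T (S z) = T z, and T z = z because S
    has only one fixed point. Conversely a fixed point of T is fixed by every
    T^k, hence by S ([random_iter_fixed]), and so it equals z. *)

(** The Picard estimate at one sample point: delta i j stands for the distance
    of the i-th and j-th iterates there. The bound delta 0 j <= M, where
    M = delta 0 1 / (1 - a), follows by induction from
    delta 0 (j + 1) <= delta 0 1 + a delta 0 j, because M = delta 0 1 + a M;
    shifting both indices by N gains a factor a ^ N. *)
Lemma contractive_semimetric_cauchy (R : realType) (a : R)
    (delta : nat -> nat -> R) :
  0 <= a < 1 ->
  (forall i, delta i i = 0) ->
  (forall i j, delta i j = delta j i) ->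
  (forall i j k, delta i k <= delta i j + delta j k) ->
  (forall i j, delta i.+1 j.+1 <= a * delta i j) ->
  forall e, 0 < e ->
  exists N, forall i j, (N <= i)%N -> (N <= j)%N -> delta i j < e.
Proof.
move=> /andP[a0 a1] delta0 deltaC deltaD deltaS e e0.
pose M := delta 0%N 1%N / (1 - a).
have b0 : 0 < 1 - a by rewrite subr_gt0.
have D0 : 0 <= delta 0%N 1%N.
  by have := deltaD 0%N 1%N 0%N; rewrite delta0 (deltaC 1%N); lra.
have bM : (1 - a) * M = delta 0%N 1%N by rewrite mulrC divfK ?gt_eqF.
have M0 : 0 <= M by rewrite divr_ge0 // ltW.
have bound j : delta 0%N j <= M.
  elim: j => [|j IH]; first by rewrite delta0.
  have aM : a * delta 0%N j <= a * M by exact: ler_wpM2l.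
  have := deltaD 0%N 1%N j.+1; have := deltaS 0%N j; lra.
have shift n i j : delta (n + i)%N (n + j)%N <= a ^+ n * delta i j.
  elim: n => [|n IH]; first by rewrite expr0 mul1r !add0n.
  by rewrite !addSn exprS -mulrA (le_trans (deltaS _ _))// ler_wpM2l.
have a2M : (fun n => a ^+ n * (M + M)) @ \oo --> (0 : R).
  rewrite -[X in _ --> X](mul0r (M + M)).
  by apply: cvgMl; apply: cvg_expr; rewrite ger0_norm.
have [N _ aN] : \forall n \near \oo, a ^+ n * (M + M) < e.
  exact: (cvgr_lt _ a2M).
exists N => i j Ni Nj; rewrite -(subnKC Ni) -(subnKC Nj).
apply: le_lt_trans (shift _ _ _) _.
apply: le_lt_trans (aN N (leqnn N)); rewrite ler_wpM2l ?exprn_ge0 //.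
by rewrite (le_trans (deltaD _ 0%N _))// (deltaC _ 0%N) lerD.
Qed.

Section random_metric.
Context (disp : measure_display) (Omega : measurableType disp) (R : realType).
Context (P : probability Omega R) (E : RMspace P).
Implicit Types (p q x y : E) (u : nat -> E) (A : set (E * E)).

Lemma ae_rdist_ge0 p q : {ae P, forall w, 0 <= rdist p q w}.
Proof.
apply: filterS2 (L0_leP _ _ (rdist_ge0 p q)) (L0_0E P) => w h e.
by rewrite e in h.
Qed.

Lemma ae_rdist_triangle p q x :
  {ae P, forall w, rdist p x w <= rdist p q w + rdist q x w}.
Proof.
apply: filterS2 (L0_leP _ _ (rdist_triangle p q x))
  (L0_addE (rdist p q) (rdist q x)) => w.
by move=> h <-.
Qed.

Lemma ae_rdist_refl p : {ae P, forall w, rdist p p w = 0}.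
Proof.
by have /rdist_eq0 -> : p = p by []; exact: L0_0E.
Qed.

Lemma el_vicinity_rdist_le e l p q x y :
  {ae P, forall w, rdist p q w <= rdist x y w} ->
  el_vicinity e l (x, y) -> el_vicinity e l (p, q).
Proof.
rewrite /el_vicinity /= => h xy; apply: (lt_le_trans xy).
apply: le_measure_ae; [exact: rdist_lt_measurable..|].
by apply: filterS h => w h; exact: le_lt_trans.
Qed.

(** The uniformity is Hausdorff: for each e > 0, letting lambda tend to 0 gives
    d(p, q) < e almost surely, and countably many e suffice. *)
Lemma el_separated p q :
  (forall A, entourage A -> A (p, q)) -> p = q.
Proof.
move=> pq.
have P1 e : 0 < e -> P [set w | rdist p q w < e] = 1%E.
  move=> e0; have mB := rdist_lt_measurable p q e.
  apply/eqP; rewrite eq_le probability_le1 //=; apply/lee_addgt0Pr => l l0.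
  (* a vicinity needs a parameter below 1, whereas l is arbitrary *)
  have l'0 : 0 < Num.min l 2^-1 < 1.
    by rewrite lt_min l0 invr_gt0 ltr0n gt_min invf_lt1 ?ltr1n ?ltr0n ?orbT.
  have entV : entourage (el_vicinity e (Num.min l 2^-1) : set (E * E)).
    by exists (e, Num.min l 2^-1).
  have := pq _ entV.
  rewrite /el_vicinity /= -leeBlDr // -EFinB => /ltW; apply: le_trans.
  by rewrite lee_fin lerB // ge_min lexx.
apply/rdist_eq0/L0P.
have small : {ae P, forall w, forall n, rdist p q w < n.+1%:R^-1}.
  apply/ae_foralln => n; exists (~` [set w | rdist p q w < n.+1%:R^-1]).
  split=> //; first by apply: measurableC; exact: rdist_lt_measurable.
  rewrite [LHS]probability_setC; last exact: rdist_lt_measurable.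
  by rewrite P1 ?subee // invr_gt0 ltr0n.
apply: filterS3 small (ae_rdist_ge0 p q) (L0_0E P) => w lt ge ->.
apply/eqP; rewrite eq_le ge andbT leNgt; apply/negP => /ltr_add_invr[n].
by rewrite add0r => /(lt_trans (lt n)); rewrite ltxx.
Qed.

(** A sequence that is almost surely Cauchy is Cauchy in probability: the
    events that all distances beyond rank N stay below e increase with N to an
    event of probability one, so some N gives probability above 1 - lambda. *)
Lemma el_cauchy_ae u :
  (forall e : R, 0 < e -> {ae P, forall w, exists N, forall i j,
     (N <= i)%N -> (N <= j)%N -> rdist (u i) (u j) w < e}) ->
  cauchy (u @ \oo).
Proof.
move=> small A [[e l] /= [e0 /andP[l0 l1]] sA].
pose B N := (\bigcap_i \bigcap_j
  [set w | rdist (u (N + i)%N) (u (N + j)%N) w < e]).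
have mB N : measurable (B N).
  by do 2 (apply: bigcapT_measurable => ?); exact: rdist_lt_measurable.
have mUB : measurable (\bigcup_N B N) by exact: bigcup_measurable.
have ndB : nondecreasing_seq B.
  move=> M N MN; apply/subsetPset => w Bw i _ j _.
  by have := Bw (N - M + i)%N I (N - M + j)%N I; rewrite /= !addnA subnKC.
have PB1 : P (\bigcup_N B N) = 1%E.
  apply/eqP; rewrite eq_le probability_le1 //= -(@probability_setT _ _ _ P).
  apply: le_measure_ae => //; apply: filterS (small e e0) => w [N Nw] _.
  by exists N => // i _ j _; apply: Nw; exact: leq_addr.
have PB : (P \o B) @ \oo --> 1%E.
  by rewrite -PB1; exact: nondecreasing_cvg_mu.
have [N _ PN] : \forall N \near \oo, ((1 - l)%:E < P (B N))%E.
  apply: (PB [set y | ((1 - l)%:E < y)%E]); apply: open_ereal_gt'.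
  by rewrite lte_fin ltrBlDr ltrDl.
exists (u @` [set i | (N <= i)%N], u @` [set i | (N <= i)%N]) => /=.
  by split; exists N => // i Ni; exists i.
move=> [_ _] /= [[i Ni <-] [j Nj <-]]; apply: sA.
apply: (lt_le_trans (PN N (leqnn N))); apply: le_measure; rewrite ?inE //=.
  exact: rdist_lt_measurable.
move=> w /(_ (i - N)%N I (j - N)%N I) /=.
by rewrite !subnKC.
Qed.

Section banach.
Context (S : E -> E) (alpha : L0 P).
Hypotheses (alpha_ge0 : 0 <= alpha) (alpha_lt1 : L0_lt_on alpha 1).
Hypothesis S_contr : forall x y, rdist (S x) (S y) <= alpha * rdist x y.

Lemma ae_ratio : {ae P, forall w, 0 <= alpha w < 1}.
Proof.
have one : {ae P, forall w, (1 : L0 P) w = 1} by exact: L0_classE.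
apply: filterS2 (filterI (L0_0E P) one)
  (filterI (L0_leP _ _ alpha_ge0) alpha_lt1) => w [e0 e1] [h0 h1].
by rewrite e0 e1 in h0 h1; apply/andP.
Qed.

Lemma ae_contraction x y :
  {ae P, forall w, rdist (S x) (S y) w <= alpha w * rdist x y w}.
Proof.
apply: filterS2 (L0_leP _ _ (S_contr x y))
  (L0_mulE alpha (rdist x y)) => w.
by move=> h <-.
Qed.

Lemma ae_nonexpansive x y :
  {ae P, forall w, rdist (S x) (S y) w <= rdist x y w}.
Proof.
apply: filterS3 (ae_contraction x y) ae_ratio (ae_rdist_ge0 x y).
by move=> w h /andP[_ /ltW a1] d0; rewrite (le_trans h)// ler_piMl.
Qed.

Lemma contraction_fixed_uniq x y : S x = x -> S y = y -> x = y.
Proof.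
move=> Sx Sy; apply/rdist_eq0/L0P; have := ae_contraction x y.
rewrite Sx Sy => h.
apply: filterS3 (filterI h (L0_0E P)) ae_ratio (ae_rdist_ge0 x y).
by move=> w [hd ->] /andP[a0 a1] d0; nra.
Qed.

(** The ratio alpha has no uniform bound below 1, so the iterates need not
    converge uniformly in the sample point; the estimate is made at each sample
    point outside one null set, common to the countably many distances. *)
Lemma cauchy_iter x : cauchy ((fun n => iter n S x) @ \oo).
Proof.
apply: el_cauchy_ae => e e0; set u := fun n => iter n S x.
have refl_u : {ae P, forall w, forall i, rdist (u i) (u i) w = 0}.
  by apply/ae_foralln => i; exact: ae_rdist_refl.
have tri_u : {ae P, forall w, forall i j k,
    rdist (u i) (u k) w <= rdist (u i) (u j) w + rdist (u j) (u k) w}.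
  by do 3 (apply/ae_foralln => ?); exact: ae_rdist_triangle.
have contr_u : {ae P, forall w, forall i j,
    rdist (u i.+1) (u j.+1) w <= alpha w * rdist (u i) (u j) w}.
  by do 2 (apply/ae_foralln => ?); exact: ae_contraction.
apply: filterS2 (filterI refl_u ae_ratio) (filterI tri_u contr_u).
move=> w [refl_w ratio_w] [tri_w contr_w].
apply: (@contractive_semimetric_cauchy R (alpha w)
  (fun i j => rdist (u i) (u j) w)) => // i j.
by rewrite rdist_sym.
Qed.

(** The limit z of the iterates is fixed: since S is nonexpansive, both z and
    S z are limits of S^(n+1) x0. *)
Lemma contraction_fixed_exists : el_complete E -> exists x, S x = x.
Proof.
move=> E_complete; case: (RM_nonempty E) => x0.
have [z uz] := E_complete _ _ (cauchy_iter x0).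
exists z; apply: el_separated => A /entourage_split_ex[B entB BA]; apply: BA.
have [[e l] el_gt0 elB] := entB.
have entV : entourage (el_vicinity e l : set (E * E)) by exists (e, l).
have [N1 _ uV] : \forall n \near \oo, el_vicinity e l (z, iter n S x0).
  exact: cvg_entourage uz _ entV.
have [N2 _ uB] : \forall n \near \oo, B (iter n S x0, z).
  exact: cvg_entourage uz _ (entourage_inv entB).
pose n := maxn N1 N2.
exists (iter n.+1 S x0) => /=; last by apply: (uB n.+1); rewrite /= leqW ?leq_maxr.
apply: elB; apply: (@el_vicinity_rdist_le _ _ _ _ z (iter n S x0)).
  exact: ae_nonexpansive.
by apply: uV; rewrite /= leq_maxl.
Qed.

End banach.

Section random_iterate.
Hypothesis E_stable : d_sigma_stable E.
Context (T : E -> E) (L : {mfun Omega >-> nat}).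
Hypothesis L_gt0 : forall w, (0 < L w)%N.

Lemma concat_cst (A : countable_partition Omega) x : concat E_stable A (fun=> x) = x.
Proof.
apply: (is_concat_uniq (concatP _ A (fun=> x))) => n.
by have /rdist_eq0 -> : x = x by []; rewrite mulr0.
Qed.

Lemma random_iter_fixed x : T x = x -> random_iter E_stable T L_gt0 x = x.
Proof.
move=> Tx; rewrite -[RHS](concat_cst (level_partition L_gt0)) /random_iter.
by congr concat; apply/funext => k; exact: iter_fix.
Qed.

(** T commutes with each T^k, and sigma-stability carries this over to their
    concatenation along the level sets of L. *)
Lemma random_iter_comm : sigma_stable_map E_stable T ->
  forall x, random_iter E_stable T L_gt0 (T x)
            = T (random_iter E_stable T L_gt0 x).
Proof.
move=> T_stable x; rewrite /random_iter T_stable.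
by congr concat; apply/funext => k; rewrite -iterSr.
Qed.

End random_iterate.

End random_metric.

Theorem theorem3p17 (disp : measure_display) (Omega : measurableType disp)
    (R : realType) (P : probability Omega R) (E : RMspace P)
    (E_stable : d_sigma_stable E) (E_complete : el_complete E)
    (T : E -> E) (T_stable : sigma_stable_map E_stable T)
    (L : {RV P >-> nat}) (L_gt0 : forall w : Omega, (0 < L w)%N)
    (alpha : L0 P) (alpha_ge0 : 0 <= alpha) (alpha_lt1 : L0_lt_on alpha 1)
    (T_contr : forall x y : E,
       rdist (random_iter E_stable T L_gt0 x) (random_iter E_stable T L_gt0 y)
         <= alpha * rdist x y) :
  exists! x : E, T x = x.
Proof.
have [z Sz] := contraction_fixed_exists alpha_ge0 alpha_lt1 T_contr E_complete.
have uniq := contraction_fixed_uniq alpha_ge0 alpha_lt1 T_contr.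
exists z; split=> [|y Ty].
  by apply: uniq (Sz); rewrite random_iter_comm // Sz.
by apply: (uniq _ _ Sz); exact: random_iter_fixed.
Qed.
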